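(* Let $(\bar A,\bar B)$ be a structurally controllable structured system with $n$ states and $m$ inputs, let $p_u(j)\ge 0$, $j=1,\dots,m$, be input costs, and let $q$ be the number of non-top linked SCC's of $D(\bar A)$. Let $f_A$ be the flow vector produced by the two-stage algorithm (minimum weight perfect matching followed by greedy selection). Then $C_{f_A}=C_{\rm OPT}$, where $C_{\rm OPT}$ is the optimal value of the linear program (LP).
   Context: Structured systems. A structured system is a pair $(\bar A,\bar B)$ with $\bar A\in\{0,\star\}^{n\times n}$, $\bar B\in\{0,\star\}^{n\times m}$. A numerical realization is a pair of real matrices $(A,B)$ of the same sizes with $A_{ij}=0$ whenever $\bar A_{ij}=0$ and $B_{ij}=0$ whenever $\bar B_{ij}=0$. $(\bar A,\bar B)$ is structurally controllable if some numerical realization $(A,B)$ is controllable, i.e. $\mathrm{rank}[B\ AB\ \cdots\ A^{n-1}B]=n$. State digraph and SCC's. $D(\bar A)$ has vertices $x_1,\dots,x_n$ and a directed edge $(x_j,x_i)$ iff $\bar A_{ij}\ne 0$. SCC means strongly connected component; an SCC is non-top linked if it has no incoming edges to its vertices from vertices of another SCC. Let $\mathcal N_1,\dots,\mathcal N_q$ be the non-top linked SCC's of $D(\bar A)$. Flow network $F(\bar A,\bar B,c)$. Vertex set $V_F=\{s,t\}\cup\{\mathcal N_i\}_{i=1}^q\cup\{x'_k\}_{k=1}^n\cup\{x_r\}_{r=1}^n\cup\{u_j\}_{j=1}^m\cup\{u'_j\}_{j=1}^m$ with source $s$ and sink $t$. Directed edge set $E_F$: $(s,\mathcal N_i)$ for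 all $i$; $(s,x'_k)$ for all $k$; $(\mathcal N_i,u'_j)$ whenever $\bar B_{rj}=\star$ for some $x_r\in\mathcal N_i$; $(x'_k,x_r)$ whenever $\bar A_{kr}\neq0$; $(x'_k,u_j)$ whenever $\bar B_{kj}\ne0$; $(u_j,u'_j)$ for all $j$; $(u'_j,t)$ for all $j$; $(x_r,t)$ for all $r$. Capacities: $b((u'_j,t))=n+1$ for all $j$, and $b(e)=1$ for every other edge. Costs: $c((u'_j,t))=p_u(j)$ for all $j$, and $c(e)=0$ for every other edge. Flows and LP. A flow vector is a function $f:E_F\to\mathbb R_{\ge0}$. It is feasible if $f(e)\le b(e)$ for all $e$ and, at every vertex other than $s,t$, total outgoing flow equals total incoming flow. Put $\varphi_f=\sum_{e=(s,v)\in E_F}f(e)$ and $C_f=\sum_{e\in E_F}c(e)f(e)$. The linear program (LP) is: minimize $C_f$ over feasible flow vectors $f$ with $\varphi_f\ge q+n$. System bipartite graph. $\mathcal B(\bar A,\bar B)$ is the undirected bipartite graph with sides $\{x_1,\dots,x_n\}\cup\{u_1,\dots,u_m\}$ and $\{x'_1,\dots,x'_n\}$, with an edge $(x_r,x'_k)$ iff $\bar A_{kr}\ne0$ and an edge $(u_j,x'_k)$ iff $\bar B_{kj}\neq0$. A perfect matching of it is a matching covering all of $x'_1,\dots,x'_n$. It exists when $(\bar A,\bar B)$ is structurally controllable. Flow constructed from a pair $(M,S)$. Let $M$ be a perfect matching of $\mathcal B(\bar A,\bar B)$ and $S\subseteq E_F$ a set containing exactly one edge $(\mathcal N_i,u'(\mathcal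 N_i))$ for each $i=1,\dots,q$, where $u'(\mathcal N_i)\in\{u'_1,\dots,u'_m\}$. The constructed flow $f$ is: $f=1$ on all $(s,x'_k)$ and all $(s,\mathcal N_i)$; $f=1$ on $(x'_k,x_r)$ and $(x_r,t)$ whenever $(x_r,x'_k)\in M$; $f=1$ on $(x'_k,u_j)$ and $(u_j,u'_j)$ whenever $(u_j,x'_k)\in M$; $f=1$ on every edge of $S$; $f((u'_j,t))=\sum_{k=1}^n\mathbb I\{(x'_k,u_j)\in M\}+\sum_{i=1}^q\mathbb I\{(\mathcal N_i,u'_j)\in S\}$ for each $j$; $f=0$ on all other edges. ($\mathbb I$ denotes an indicator; edges of $M$ are unordered.) Two-stage algorithm. Stage 1: assign weight $0$ to each edge $(x_r,x'_k)$ and weight $p_u(j)$ to each edge $(u_j,x'_k)$ of $\mathcal B(\bar A,\bar B)$, and let $M_A$ be a minimum weight perfect matching. Stage 2: for each $i=1,\dots,q$ choose $u(\mathcal N_i)\in\arg\min\{p_u(j): u_j \text{ with }(\mathcal N_i,u'_j)\in E_F\}$, with corresponding primed node $u'(\mathcal N_i)$, and let $S_A=\{(\mathcal N_i,u'(\mathcal N_i))\}_{i=1}^q$. Output: $f_A$, the flow constructed from $(M_A,S_A)$. *)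

(* Defs.v *)
From HB Require Import structures.
From mathcomp Require Import all_boot all_order all_algebra.
From mathcomp Require Import boolp classical_sets reals constructive_ereal.
From mathcomp Require Import ereal.

Set Implicit Arguments.
Unset Strict Implicit.
Unset Printing Implicit Defensive.

Import Order.TTheory GRing.Theory Num.Theory.
Local Open Scope ring_scope.

(* A pattern in {0, *}^(n x m) is a boolean matrix; [true] stands for the star,
   so that "entry <> 0" is the boolean entry itself. *)
Notation pattern n m := 'M[bool]_(n, m).

Definition is_realization (R : realType) (n m : nat)
    (Abar : pattern n n) (Bbar : pattern n m)
    (A : 'M[R]_n) (B : 'M[R]_(n, m)) : Prop :=
  (forall i j, ~~ Abar i j -> A i j = 0) /\
  (forall i j, ~~ Bbar i j -> B i j = 0).

(* [B, A B, ..., A^(n-1) B] *)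
Definition controllability_mx (R : realType) (n m : nat)
    (A : 'M[R]_n) (B : 'M[R]_(n, m)) : 'M[R]_(n, \sum_(k < n) m) :=
  \mxrow_(k < n) (A ^+ k *m B).

Definition controllable (R : realType) (n m : nat)
    (A : 'M[R]_n) (B : 'M[R]_(n, m)) : Prop :=
  \rank (controllability_mx A B) = n.

Definition structurally_controllable (R : realType) (n m : nat)
    (Abar : pattern n n) (Bbar : pattern n m) : Prop :=
  exists (A : 'M[R]_n) (B : 'M[R]_(n, m)),
    is_realization Abar Bbar A B /\ controllable A B.

(* Mind the transposition: x_j -> x_i is an edge iff Abar i j is a star. *)
Definition state_edge (n : nat) (Abar : pattern n n) : rel 'I_n :=
  fun j i => Abar i j.

Definition sccs (n : nat) (Abar : pattern n n) : {set {set 'I_n}} :=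
  equivalence_partition
    (fun x y => connect (state_edge Abar) x y && connect (state_edge Abar) y x)
    [set: 'I_n].

Definition non_top_linked (n : nat) (Abar : pattern n n) (N : {set 'I_n}) :
    bool :=
  [forall D in sccs Abar, (D != N) ==>
     [forall y in D, [forall x in N, ~~ state_edge Abar y x]]].

Definition ntl_sccs (n : nat) (Abar : pattern n n) : {set {set 'I_n}} :=
  [set N in sccs Abar | non_top_linked Abar N].

(* The index type of N_1, ..., N_q. *)
Definition ntl (n : nat) (Abar : pattern n n) : Type :=
  {N : {set 'I_n} | N \in ntl_sccs Abar}.

Definition num_ntl (n : nat) (Abar : pattern n n) : nat := #|ntl_sccs Abar|.

(* V_F: [Vx' k] is x'_k, [Vx r] is x_r, [Vu j] is u_j and [Vu' j] is u'_j. *)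
Inductive vertex (n m : nat) (Abar : pattern n n) : Type :=
| Vs
| Vt
| VN of ntl Abar
| Vx' of 'I_n
| Vx of 'I_n
| Vu of 'I_m
| Vu' of 'I_m.
Arguments Vs {n m Abar}.
Arguments Vt {n m Abar}.
Arguments VN {n m Abar} _.
Arguments Vx' {n m Abar} _.
Arguments Vx {n m Abar} _.
Arguments Vu {n m Abar} _.
Arguments Vu' {n m Abar} _.

(* An encoding used only to equip [vertex] with its finType structure. *)
Definition vertex_enc (n m : nat) (Abar : pattern n n) (v : vertex m Abar) :
    bool + ntl Abar + ('I_n + 'I_n) + ('I_m + 'I_m) :=
  match v with
  | Vs => inl (inl (inl true))
  | Vt => inl (inl (inl false))
  | VN N => inl (inl (inr N))
  | Vx' k => inl (inr (inl k))
  | Vx r => inl (inr (inr r))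
  | Vu j => inr (inl j)
  | Vu' j => inr (inr j)
  end.

Definition vertex_dec (n m : nat) (Abar : pattern n n)
    (c : bool + ntl Abar + ('I_n + 'I_n) + ('I_m + 'I_m)) : vertex m Abar :=
  match c with
  | inl (inl (inl true)) => Vs
  | inl (inl (inl false)) => Vt
  | inl (inl (inr N)) => VN N
  | inl (inr (inl k)) => Vx' k
  | inl (inr (inr r)) => Vx r
  | inr (inl j) => Vu j
  | inr (inr j) => Vu' j
  end.

Lemma vertex_encK (n m : nat) (Abar : pattern n n) :
  cancel (@vertex_enc n m Abar) (@vertex_dec n m Abar).
Proof. by case. Qed.

HB.instance Definition _ (n m : nat) (Abar : pattern n n) :=
  Finite.copy (vertex m Abar) (can_type (@vertex_encK n m Abar)).

Definition flow_edge (n m : nat) (Abar : pattern n n) (Bbar : pattern n m) :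
    rel (vertex m Abar) :=
  fun v w => match v, w with
  | Vs, VN _ => true
  | Vs, Vx' _ => true
  | VN N, Vu' j => [exists r in val N, Bbar r j]
  | Vx' k, Vx r => Abar k r
  | Vx' k, Vu j => Bbar k j
  | Vu j, Vu' j' => j == j'
  | Vu' _, Vt => true
  | Vx _, Vt => true
  | _, _ => false
  end.

(* E_F *)
Definition edge (n m : nat) (Abar : pattern n n) (Bbar : pattern n m) : Type :=
  {e : vertex m Abar * vertex m Abar | flow_edge Bbar e.1 e.2}.

Definition src (n m : nat) (Abar : pattern n n) (Bbar : pattern n m)
  (e : edge Abar Bbar) : vertex m Abar := (val e).1.
Definition tgt (n m : nat) (Abar : pattern n n) (Bbar : pattern n m)
  (e : edge Abar Bbar) : vertex m Abar := (val e).2.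

Definition capacity (R : realType) (n m : nat)
    (Abar : pattern n n) (Bbar : pattern n m) (e : edge Abar Bbar) : R :=
  match src e, tgt e with
  | Vu' _, Vt => n.+1%:R
  | _, _ => 1
  end.

Definition edge_cost (R : realType) (n m : nat)
    (Abar : pattern n n) (Bbar : pattern n m) (pu : 'I_m -> R)
    (e : edge Abar Bbar) : R :=
  match src e, tgt e with
  | Vu' j, Vt => pu j
  | _, _ => 0
  end.

Definition feasible_flow (R : realType) (n m : nat)
    (Abar : pattern n n) (Bbar : pattern n m) (f : edge Abar Bbar -> R) : Prop :=
  [/\ forall e, 0 <= f e,
      forall e, f e <= capacity R e
    & forall v, v != Vs -> v != Vt ->
        \sum_(e | src e == v) f e = \sum_(e | tgt e == v) f e].

Definition flow_value (R : realType) (n m : nat)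
    (Abar : pattern n n) (Bbar : pattern n m) (f : edge Abar Bbar -> R) : R :=
  \sum_(e | src e == Vs) f e.

Definition flow_cost (R : realType) (n m : nat)
    (Abar : pattern n n) (Bbar : pattern n m) (pu : 'I_m -> R)
    (f : edge Abar Bbar -> R) : R :=
  \sum_e edge_cost pu e * f e.

Definition lp_feasible (R : realType) (n m : nat)
    (Abar : pattern n n) (Bbar : pattern n m) : set (edge Abar Bbar -> R) :=
  fun f => feasible_flow f /\ (num_ntl Abar + n)%:R <= flow_value f.

(* The infimum is taken in the extended reals: an infeasible program would
   have the value +oo, hence no default value can be mistaken for an optimum. *)
Definition lp_optimal_value (R : realType) (n m : nat)
    (Abar : pattern n n) (Bbar : pattern n m) (pu : 'I_m -> R) : \bar R :=
  ereal_inf ((fun f => (flow_cost pu f)%:E) @` @lp_feasible R n m Abar Bbar)%classic.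

(* The left vertices of the system bipartite graph are [inl r] for x_r and
   [inr j] for u_j; an undirected edge is represented by the pair of its left
   end and the index k of its right end x'_k. *)
Notation bip_edge n m := (('I_n + 'I_m) * 'I_n)%type.

Definition bip_edges (n m : nat) (Abar : pattern n n) (Bbar : pattern n m) :
    {set bip_edge n m} :=
  [set e : bip_edge n m |
     match e.1 with inl r => Abar e.2 r | inr j => Bbar e.2 j end].

Definition matching (n m : nat) (Abar : pattern n n) (Bbar : pattern n m)
    (M : {set bip_edge n m}) : Prop :=
  M \subset bip_edges Abar Bbar /\
  {in M &, forall e e', e != e' -> e.1 != e'.1 /\ e.2 != e'.2}.

Definition perfect_matching (n m : nat) (Abar : pattern n n)
    (Bbar : pattern n m) (M : {set bip_edge n m}) : Prop :=
  matching Abar Bbar M /\ forall k, exists2 e, e \in M & e.2 = k.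

Definition bip_weight (R : realType) (n m : nat) (pu : 'I_m -> R)
    (e : bip_edge n m) : R :=
  match e.1 with inl _ => 0 | inr j => pu j end.

Definition min_weight_perfect_matching (R : realType) (n m : nat)
    (Abar : pattern n n) (Bbar : pattern n m) (pu : 'I_m -> R)
    (M : {set bip_edge n m}) : Prop :=
  perfect_matching Abar Bbar M /\
  forall M', perfect_matching Abar Bbar M' ->
    \sum_(e in M) bip_weight pu e <= \sum_(e in M') bip_weight pu e.

Definition greedy_selection (R : realType) (n m : nat)
    (Abar : pattern n n) (Bbar : pattern n m) (pu : 'I_m -> R)
    (u : ntl Abar -> 'I_m) : Prop :=
  forall N, flow_edge Bbar (VN N) (Vu' (u N)) /\
    forall j, flow_edge Bbar (VN N) (Vu' j) -> pu (u N) <= pu j.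

Definition selection_set (n m : nat) (Abar : pattern n n)
    (Bbar : pattern n m) (u : ntl Abar -> 'I_m) : {set edge Abar Bbar} :=
  [set e | [exists N, (src e == VN N) && (tgt e == Vu' (u N))]].

(* On the edges (x_r, t) and (u_j, u'_j) the flow is 1 when x_r, resp. u_j, is
   covered by M. *)
Definition constructed_flow (R : realType) (n m : nat)
    (Abar : pattern n n) (Bbar : pattern n m)
    (M : {set bip_edge n m}) (S : {set edge Abar Bbar}) (e : edge Abar Bbar) :
    R :=
  match src e, tgt e with
  | Vs, _ => 1
  | Vx' k, Vx r => ((inl r, k) \in M)%:R
  | Vx r, Vt => [exists k, (inl r, k) \in M]%:R
  | Vx' k, Vu j => ((inr j, k) \in M)%:R
  | Vu j, Vu' _ => [exists k, (inr j, k) \in M]%:R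
  | VN _, Vu' _ => (e \in S)%:R
  | Vu' j, Vt =>
      \sum_(k < n) ((inr j, k) \in M)%:R
      + \sum_(N : ntl Abar)
          [exists e' in S, (src e' == VN N) && (tgt e' == Vu' j)]%:R
  | _, _ => 0
  end.

(* [f] is an output of the algorithm for some way of breaking the ties in the
   two minimisations. *)
Definition two_stage_output (R : realType) (n m : nat)
    (Abar : pattern n n) (Bbar : pattern n m) (pu : 'I_m -> R)
    (f : edge Abar Bbar -> R) : Prop :=
  exists (M : {set bip_edge n m}) (u : ntl Abar -> 'I_m),
    [/\ min_weight_perfect_matching Abar Bbar pu M,
        greedy_selection Bbar pu u
      & f = constructed_flow R M (selection_set Bbar u)].

(* Main.v *)
Require Import Defs.
From HB Require Import structures.
From mathcomp Require Import all_boot all_order all_algebra.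
From mathcomp Require Import boolp classical_sets reals constructive_ereal.
From mathcomp Require Import ereal.

Set Implicit Arguments.
Unset Strict Implicit.
Unset Printing Implicit Defensive.

Import Order.TTheory GRing.Theory Num.Theory.
Local Open Scope ring_scope.

(** A flow of value at least [q + n] fills every edge leaving the source, since
these are [q + n] edges of capacity 1.  Flow conservation then rewrites its cost
as the sum of two independent terms.

On the edges from the SCC's [N] to the inputs, each [N] distributes one unit of
flow over the inputs that it can use, so it pays at least the cheapest of them:
this is what the greedy selection pays.

On the edges from [x'_k] to the [x_r] and [u_j], the flow is a fractional
perfect matching of the system bipartite graph: each [x'_k] sends one unit, each
[x_r] and [u_j] receives at most one.  Its cost is its weight, and by
Birkhoff's theorem no fractional matching is lighter than the lightest perfect
matching ([fractional_matching_bound]).  Here Birkhoff's theorem takes the form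
of a lower bound ([const_line_sums_bound]): Hall's marriage theorem
([hall_marriage]) gives a bijection inside the support of a nonnegative matrix
with constant line sums, and subtracting a multiple of its permutation matrix
shrinks the support.

Both terms are bounded at once in [lp_feasible_cost_ge].  The bound is attained:
the constructed flow is feasible for the program ([constructed_lp_feasible]) and
its cost is the weight of the matching plus the cost of the selected inputs
([constructed_cost]).  The edge [(u'_j, t)] is wide enough for it, as it carries at
most one unit from the matching and one from each of the at most [n] SCC's. *)

(** * Hall's marriage theorem *)

(** A set violating Hall's condition for [E'] contains [i], the only index where
[E'] differs from [E]; it is [i] together with the set [S] of the conclusion. *)
Lemma leq_hall_violator (T U : finType) (E E' : T -> {set U}) (i : T) :
  (forall j, j != i -> E' j = E j) ->
  (forall S : {set T}, #|S| <= #|\bigcup_(j in S) E j|)%N ->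
  ~~ [forall S : {set T}, #|S| <= #|\bigcup_(j in S) E' j|]%N ->
  exists2 S : {set T}, i \notin S
    & (#|(\bigcup_(j in S) E j) :|: E' i| <= #|S|)%N.
Proof.
move=> eqE hE /forallPn[S]; rewrite -ltnNge => hS.
have eqU (S' : {set T}) : i \notin S' ->
    \bigcup_(j in S') E' j = \bigcup_(j in S') E j.
  move=> iS; apply: eq_bigr => j jS; apply: eqE.
  by apply: contraNneq iS => <-.
have iS : i \in S.
  by apply: contraTT hS => iS; rewrite eqU // -leqNgt.
have iSi : i \notin S :\ i by rewrite !inE eqxx.
exists (S :\ i) => //.
rewrite -ltnS (_ : #|S :\ i|.+1 = #|S|); last by rewrite (cardsD1 i S) iS.
by rewrite -eqU // finset.setUC -big_setU1 // finset.setD1K.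
Qed.

(** Induction on the total size of the family.  If some [E i] has two elements
[x] and [y], one of them can be removed without breaking Hall's condition:
violators [S] and [S'] of the two reduced families would give, for
[P := (\bigcup_(j in S) E j) :|: E i :\ x] and the analogous [Q] for [S'] and
[y], that [#|P| + #|Q| <= #|S| + #|S'|].  But [P :|: Q] contains the neighbours
of [i |: (S :|: S')], because [x] and [y] differ, and [P :&: Q] those of
[S :&: S'], so Hall's condition yields
[#|S :|: S'| + 1 + #|S :&: S'| <= #|P| + #|Q|].  When all [E i] are singletons,
Hall's condition on pairs is injectivity. *)
Lemma hall_marriage (T U : finType) (E : T -> {set U}) :
  (forall S : {set T}, #|S| <= #|\bigcup_(i in S) E i|)%N ->
  exists2 f : T -> U, injective f & forall i, f i \in E i.
Proof.
have [d] := ubnP (\sum_i #|E i|); elim: d E => // d IHd E ltd hE.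
have E_gt0 i : (0 < #|E i|)%N by have := hE [set i]; rewrite cards1 big_set1.
have [/forallP E_le1|/forallPn[i]] := boolP [forall i, #|E i| <= 1]%N.
  have [f fE] : exists f : T -> U, forall i, E i = [set f i].
    have /fin_all_exists[f fP] : forall i, exists x, E i = [set x]
      by move=> i; apply/cards1P; rewrite eqn_leq E_le1 E_gt0.
    by exists f.
  exists f => [i j fij|i]; last by rewrite fE finset.set11.
  apply/eqP; apply: contraT => ij.
  have := hE [set i; j].
  by rewrite cards2 ij big_setU1 ?inE // big_set1 !fE fij /= finset.setUid cards1.
rewrite -ltnNge => /card_gt1P[x [y [xE yE xy]]].
pose rem z j := if j == i then E i :\ z else E j.
have rem_i z : rem z i = E i :\ z by rewrite /rem eqxx.
have rem_j z j : j != i -> rem z j = E j by rewrite /rem => /negPf->.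
have sub_rem z j : rem z j \subset E j.
  by rewrite /rem; case: eqP => [->|//]; apply: finset.subsetDl.
have step z : z \in E i ->
    [forall S : {set T}, #|S| <= #|\bigcup_(j in S) rem z j|]%N ->
    exists2 f : T -> U, injective f & forall j, f j \in E j.
  move=> zE /forallP /IHd[|f injf fP].
    rewrite -ltnS; apply: leq_trans ltd; rewrite ltnS.
    rewrite (bigD1 i) //= [X in (_ <= X)%N](bigD1 i) //= -addSn rem_i.
    rewrite [X in (_ <= X + _)%N](cardsD1 z) zE add1n leq_add2l leq_sum // => j ji.
    by rewrite rem_j.
  by exists f => // j; apply: (fintype.subsetP (sub_rem z j)).
have [/(step _ xE)//|/(leq_hall_violator (rem_j x) hE)[S iS leS]] :=
  boolP [forall S : {set T}, #|S| <= #|\bigcup_(j in S) rem x j|]%N.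
have [/(step _ yE)//|/(leq_hall_violator (rem_j y) hE)[S' iS' leS']] :=
  boolP [forall S : {set T}, #|S| <= #|\bigcup_(j in S) rem y j|]%N.
exfalso; move: leS leS'; rewrite !rem_i => leS leS'.
set P := _ :|: _ in leS; set Q := _ :|: _ in leS'.
have leU : (#|i |: (S :|: S')| <= #|P :|: Q|)%N.
  apply: leq_trans (hE _) _; apply/subset_leq_card/finset.bigcupsP => j.
  rewrite !inE => /or3P[/eqP->|jS|jS'].
  - apply/fintype.subsetP => z zE; rewrite !inE zE !andbT.
    by case: (eqVneq z x) => [->|]; rewrite ?xy ?orbT //.
  - apply/finset.subsetU/orP; left; apply/finset.subsetU/orP; left.
    exact: finset.bigcup_sup.
  - apply/finset.subsetU/orP; right; apply/finset.subsetU/orP; left.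
    exact: finset.bigcup_sup.
have leI : (#|S :&: S'| <= #|P :&: Q|)%N.
  apply: leq_trans (hE _) _; apply/subset_leq_card/finset.bigcupsP => j.
  rewrite inE => /andP[jS jS']; rewrite finset.subsetI.
  by apply/andP; split; apply/finset.subsetU/orP; left; apply: finset.bigcup_sup.
have iSS : i \notin S :|: S' by rewrite inE negb_or iS.
have := leq_add leU leI; rewrite cardsU1 iSS -addnA !cardsUI add1n ltnNge.
by rewrite leq_add.
Qed.

(** * Weights of fractional matchings *)

(** If [c] is positive then the support of [A] contains the graph of a bijection
[s], by Hall's theorem: a set [S] of rows carries the mass [c * #|S|], which has
to fit in the columns that the support meets in [S], each of mass [c].  Subtracting from [A] its least entry [t] along [s]
times the permutation matrix of [s] lowers the line sums to [c - t] and kills an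
entry, so induction applies; the part removed weighs at least [t * w]. *)
Lemma const_line_sums_bound (R : realFieldType) (T U : finType)
    (E : T -> U -> bool) (W : T -> U -> R) (w : R) :
  #|T| = #|U| ->
  (forall s : T -> U, injective s -> (forall i, E i (s i)) ->
     w <= \sum_i W i (s i)) ->
  forall (A : T -> U -> R) (c : R),
    (forall i j, 0 <= A i j) ->
    (forall i j, A i j != 0 -> E i j) ->
    (forall i, \sum_j A i j = c) -> (forall j, \sum_i A i j = c) ->
    0 <= c ->
    c * w <= \sum_i \sum_j W i j * A i j.
Proof.
move=> cardTU hw A c.
have [d] := ubnP #|[set p : T * U | A p.1 p.2 != 0]|.
elim: d A c => // d IHd A c ltd A_ge0 AE rowA colA.
rewrite le_eqVlt => /predU1P[c0|c_gt0].
  have A0 i j : A i j = 0.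
    apply: (psumr_eq0P (P := predT) (F := A i)) => //.
    by rewrite rowA.
  rewrite -c0 mul0r big1 // => i _; rewrite big1 // => j _.
  by rewrite A0 mulr0.
have [S|s s_inj sA] := @hall_marriage T U (fun i => [set j | A i j != 0]).
  rewrite -(ler_nat R) -(ler_pM2l c_gt0).
  set N := \bigcup_(i in S) _.
  have -> : c * #|S|%:R = \sum_(j in N) \sum_(i in S) A i j.
    rewrite exchange_big /= mulr_natr -sumr_const; apply: eq_bigr => i iS.
    rewrite -(rowA i) (bigID (mem N)) /= [X in _ + X]big1 ?addr0 // => j.
    apply: contraNeq => Aij; apply/finset.bigcupP; exists i => //.
    by rewrite inE.
  rewrite mulr_natr -sumr_const; apply: ler_sum => j _.
  rewrite -(colA j) [X in _ <= X](bigID (mem S)) /= lerDl.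
  by apply: sumr_ge0.
have {}sA i : A i (s i) != 0 by have := sA i; rewrite inE.
have [i0 _|T0] := pickP (mem T); last first.
  (* Empty index types: [c] is then unrelated to [A], but [w] is at most the
     empty sum. *)
  have := hw s s_inj (fun i => AE _ _ (sA i)).
  rewrite !big_pred0 // => w_le0.
  by rewrite mulr_ge0_le0 // ltW.
have [i1 _ t_min] := @arg_minP _ R T i0 predT (fun i => A i (s i)) isT.
set t := A i1 (s i1) in t_min.
have t_gt0 : 0 < t by rewrite lt_def sA A_ge0.
pose A' i j := A i j - t * (j == s i)%:R.
have [s' sK s'K] : bijective s by apply: inj_card_bij => //; rewrite cardTU.
have A'_ge0 i j : 0 <= A' i j.
  rewrite /A'; case: eqP => [->|_]; rewrite ?mulr1 ?mulr0 ?subr0 //.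
  by rewrite subr_ge0 t_min.
have A'A i j : A' i j != 0 -> A i j != 0.
  apply: contraNneq => Aij; move: (A'_ge0 i j); rewrite /A' Aij sub0r oppr_ge0.
  by move=> h; rewrite oppr_eq0 eq_le h mulr_ge0 // ltW.
have rowA' i : \sum_j A' i j = c - t.
  rewrite sumrB rowA -mulr_sumr (bigD1 (s i)) //= eqxx big1 ?addr0 ?mulr1 //.
  by move=> j /negPf->.
have colA' j : \sum_i A' i j = c - t.
  rewrite sumrB colA -mulr_sumr (bigD1 (s' j)) //= s'K eqxx big1 ?addr0 ?mulr1 //.
  by move=> i; rewrite -(inj_eq s_inj) s'K eq_sym => /negPf->.
have ct : 0 <= c - t by rewrite -(rowA' i0) sumr_ge0.
have lt' : (#|[set p : T * U | A' p.1 p.2 != 0%R]| < d)%N.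
  rewrite -ltnS; apply: leq_trans ltd; rewrite ltnS.
  apply: proper_card; apply/properP; split.
    by apply/fintype.subsetP => p; rewrite !inE; apply: A'A.
  exists (i1, s i1); rewrite !inE /= ?sA //.
  by rewrite /A' eqxx mulr1 subrr eqxx.
have := IHd A' _ lt' A'_ge0 (fun i j h => AE i j (A'A i j h)) rowA' colA' ct.
have ws := hw s s_inj (fun i => AE _ _ (sA i)).
have -> : \sum_i \sum_j W i j * A i j =
    t * (\sum_i W i (s i)) + \sum_i \sum_j W i j * A' i j.
  rewrite mulr_sumr -big_split /=; apply: eq_bigr => i _.
  rewrite [X in X + _](_ : _ = \sum_j t * (W i j * (j == s i)%:R)).
    rewrite -big_split /=; apply: eq_bigr => j _.
    by rewrite /A' mulrBr mulrCA addrC subrK.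
  rewrite (bigD1 (s i)) //= eqxx mulr1 big1 ?addr0 // => j /negPf->.
  by rewrite !mulr0.
move=> h; rewrite -{1}(subrKC t c) mulrDl.
by apply: lerD => //; rewrite ler_pM2l.
Qed.

(** [A] has row sums 1 but column sums at most 1.  With the diagonal matrix [D] of
the defects of its column sums, the square block matrix [[A, 0], [D, A^T]] has
all line sums equal to 1.  A bijection inside its support maps the first block
of rows to the first block of columns, hence restricts to an injection, and the
other blocks get weight 0. *)
Lemma fractional_matching_bound (R : realFieldType) (K L : finType)
    (E : K -> L -> bool) (W : K -> L -> R) (w : R) :
  (forall s : K -> L, injective s -> (forall k, E k (s k)) ->
     w <= \sum_k W k (s k)) ->
  forall A : K -> L -> R,
    (forall k l, 0 <= A k l) ->
    (forall k l, A k l != 0 -> E k l) ->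
    (forall k, \sum_l A k l = 1) -> (forall l, \sum_k A k l <= 1) ->
    w <= \sum_k \sum_l W k l * A k l.
Proof.
move=> hw A A_ge0 AE rowA colA.
pose E2 (i : K + L) (j : L + K) :=
  match i, j with inl k, inl l => E k l | inl _, inr _ => false | _, _ => true end.
pose W2 (i : K + L) (j : L + K) :=
  match i, j with inl k, inl l => W k l | _, _ => 0 end.
pose A2 (i : K + L) (j : L + K) :=
  match i, j with
  | inl k, inl l => A k l
  | inl _, inr _ => 0
  | inr l, inl l' => (1 - \sum_k A k l) * (l' == l)%:R
  | inr l, inr k => A k l
  end.
have sumdelta (I : finType) (i : I) (x : I -> R) :
    \sum_j x j * (i == j)%:R = x i.
  rewrite (bigD1 i) //= eqxx mulr1 big1 ?addr0 // => j; rewrite eq_sym => /negPf->.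
  by rewrite mulr0.
have := @const_line_sums_bound R _ _ E2 W2 w _ _ A2 1.
have -> : \sum_i \sum_j W2 i j * A2 i j = \sum_k \sum_l W k l * A k l.
  rewrite big_sumType /= [X in _ + X]big1 ?addr0 => [|l _].
    apply: eq_bigr => k _; rewrite big_sumType /= [X in _ + X]big1 ?addr0 //.
    by move=> k' _; apply: mul0r.
  by rewrite big1 // => j _; apply: mul0r.
rewrite mul1r; apply.
- by rewrite !card_sum addnC.
- move=> s s_inj sE.
  have [s1 s1P] : exists s1 : K -> L, forall k, s (inl k) = inl (s1 k).
    apply: (@fin_all_exists _ _ (fun k l => s (inl k) = inl l)) => k.
    by have := sE (inl k); case: (s (inl k)) => // l _; exists l.
  rewrite big_sumType /= [X in _ + X]big1 ?addr0 //.
  under eq_bigr do rewrite s1P.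
  apply: hw => [k k' e|k]; last by have := sE (inl k); rewrite s1P.
  by have /s_inj[] : s (inl k) = s (inl k') by rewrite !s1P e.
- case=> [k|l] [l'|k']; rewrite /A2 //.
  by rewrite mulr_ge0 ?ler0n // subr_ge0.
- by case=> [k|l] [l'|k']; rewrite /A2 /E2 ?eqxx //; apply: AE.
- case=> [k|l]; rewrite big_sumType /=; first by rewrite [X in _ + X]big1 ?addr0.
  under eq_bigr do rewrite eq_sym.
  by rewrite (sumdelta _ l (fun=> 1 - \sum_k A k l)) subrK.
- case=> [l|k]; rewrite big_sumType /=; last by rewrite big1 ?add0r.
  by rewrite (sumdelta _ l (fun l => 1 - \sum_k A k l)) subrKC.
- exact: ler01.
Qed.

(** * Edge sums of the flow network *)

Section FlowNetwork.

Variables (R : realType) (n m : nat)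
  (Abar : 'M[bool]_(n, n)) (Bbar : 'M[bool]_(n, m)).

(** Extending a flow by 0 to all pairs of vertices turns sums over the edges at a
vertex into unrestricted sums over vertices. *)
Definition arc_flow (f : edge Abar Bbar -> R) (v w : vertex m Abar) : R :=
  oapp f 0 (insub (v, w) : option {e | flow_edge Bbar e.1 e.2}).

Lemma arcE f v w (vw : flow_edge Bbar v w) :
  arc_flow f v w = f (exist (fun e => flow_edge Bbar e.1 e.2) (v, w) vw).
Proof. by rewrite /arc_flow insubT. Qed.

Lemma arc_val f (e : edge Abar Bbar) : arc_flow f (src e) (tgt e) = f e.
Proof. by rewrite /arc_flow /src /tgt -surjective_pairing valK. Qed.

Lemma arc_nonedge f v w : ~~ flow_edge Bbar v w -> arc_flow f v w = 0.
Proof. by move=> vw; rewrite /arc_flow insubF //; apply/negbTE. Qed.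

Lemma sum_edge f (P : pred (vertex m Abar * vertex m Abar)) :
  \sum_(e : edge Abar Bbar | P (val e)) f e = \sum_(p | P p) arc_flow f p.1 p.2.
Proof.
rewrite [RHS](bigID (fun p => flow_edge Bbar p.1 p.2)) /= [X in _ + X]big1 ?addr0.
  rewrite (reindex_omap (val : edge Abar Bbar -> _) insub) => [|p /andP[_ pE]].
    apply: eq_big => [e|e _]; last exact: esym (arc_val f e).
    by rewrite valK eqxx (valP e) !andbT.
  by case: insubP => [e _ <-|]; rewrite ?pE.
by move=> p /andP[_]; apply: arc_nonedge.
Qed.

Lemma outflowE f v : \sum_(e : edge Abar Bbar | src e == v) f e = \sum_w arc_flow f v w.
Proof.
rewrite (sum_edge f (fun p => p.1 == v)).
transitivity (\sum_(v' | v' == v) \sum_w arc_flow f v' w); last by rewrite big_pred1_eq.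
by rewrite pair_big /=; apply: eq_bigl => p; rewrite andbT.
Qed.

Lemma inflowE f v : \sum_(e : edge Abar Bbar | tgt e == v) f e = \sum_w arc_flow f w v.
Proof.
rewrite (sum_edge f (fun p => p.2 == v)).
rewrite -(pair_big predT (pred1 v) (arc_flow f)) /=.
by apply: eq_bigr => w _; rewrite big_pred1_eq.
Qed.

Lemma sum_vertex (F : vertex m Abar -> R) :
  \sum_v F v = F Vs + F Vt + \sum_N F (VN N) + (\sum_k F (Vx' k) + \sum_r F (Vx r))
    + (\sum_j F (Vu j) + \sum_j F (Vu' j)).
Proof.
rewrite (reindex (@vertex_dec n m Abar)) /=; last first.
  exists (@vertex_enc n m Abar) => [[[[[]|]|[]]|[]]|] // v _; exact: vertex_encK.
by rewrite !big_sumType big_bool.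
Qed.

(* Splits a sum over vertices by kind of vertex and drops the summands which
   pair vertices that are never adjacent. *)
Ltac sum_over_neighbours := rewrite sum_vertex;
  repeat match goal with
    | |- context [bigop.body ?z ?r ?F] =>
        rewrite (_ : bigop.body z r F = 0);
          [| by apply: big1 => ? _; apply: arc_nonedge]
    | |- context [arc_flow ?f ?v ?w] => rewrite (_ : arc_flow f v w = 0);
          [| by apply: arc_nonedge]
    end;
  rewrite ?(addr0, add0r).

Lemma outflow_s f :
  \sum_w arc_flow f Vs w =
    \sum_N arc_flow f Vs (VN N) + \sum_k arc_flow f Vs (Vx' k).
Proof. by sum_over_neighbours. Qed.

Lemma outflow_N f N : \sum_w arc_flow f (VN N) w = \sum_j arc_flow f (VN N) (Vu' j).
Proof. by sum_over_neighbours. Qed.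

Lemma inflow_N f N : \sum_w arc_flow f w (VN N) = arc_flow f Vs (VN N).
Proof. by sum_over_neighbours. Qed.

Lemma outflow_x' f k :
  \sum_w arc_flow f (Vx' k) w =
    \sum_r arc_flow f (Vx' k) (Vx r) + \sum_j arc_flow f (Vx' k) (Vu j).
Proof. by sum_over_neighbours. Qed.

Lemma inflow_x' f k : \sum_w arc_flow f w (Vx' k) = arc_flow f Vs (Vx' k).
Proof. by sum_over_neighbours. Qed.

Lemma outflow_x f r : \sum_w arc_flow f (Vx r) w = arc_flow f (Vx r) Vt.
Proof. by sum_over_neighbours. Qed.

Lemma inflow_x f r : \sum_w arc_flow f w (Vx r) = \sum_k arc_flow f (Vx' k) (Vx r).
Proof. by sum_over_neighbours. Qed.

Lemma outflow_u f j : \sum_w arc_flow f (Vu j) w = arc_flow f (Vu j) (Vu' j).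
Proof.
sum_over_neighbours; rewrite (bigD1 j) //= big1 ?addr0 // => j' jj'.
by apply: arc_nonedge; rewrite /= eq_sym.
Qed.

Lemma inflow_u f j : \sum_w arc_flow f w (Vu j) = \sum_k arc_flow f (Vx' k) (Vu j).
Proof. by sum_over_neighbours. Qed.

Lemma outflow_u' f j : \sum_w arc_flow f (Vu' j) w = arc_flow f (Vu' j) Vt.
Proof. by sum_over_neighbours. Qed.

Lemma inflow_u' f j :
  \sum_w arc_flow f w (Vu' j) =
    \sum_N arc_flow f (VN N) (Vu' j) + arc_flow f (Vu j) (Vu' j).
Proof.
sum_over_neighbours; congr (_ + _).
by rewrite (bigD1 j) //= big1 ?addr0 // => j' jj'; apply: arc_nonedge.
Qed.

Lemma flow_costE pu f : flow_cost pu f = \sum_j pu j * arc_flow f (Vu' j) Vt.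
Proof.
have arc_cost v w : arc_flow (fun e => edge_cost pu e * f e) v w =
    match v, w with Vu' j, Vt => pu j * arc_flow f (Vu' j) Vt | _, _ => 0 end.
  have [vw|vw] := boolP (flow_edge Bbar v w).
    by rewrite arcE /edge_cost /=; case: v w vw => [||?|?|?|?|?] [||?|?|?|?|?] //= vw;
      rewrite ?mul0r // arcE.
  by rewrite arc_nonedge //; case: v w vw => [||?|?|?|?|?] [||?|?|?|?|?].
rewrite /flow_cost (sum_edge (fun e => edge_cost pu e * f e) predT).
rewrite -(pair_big predT predT (arc_flow (fun e => edge_cost pu e * f e))) /=.
transitivity (\sum_(v : vertex m Abar)
    if v is Vu' j then pu j * arc_flow f (Vu' j) Vt else 0).
  apply: eq_bigr => v _; under eq_bigr do rewrite arc_cost.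
  rewrite sum_vertex; case: v => [||?|?|?|?|j]; rewrite !big1_eq ?addr0 ?add0r //.
by rewrite sum_vertex !big1_eq ?addr0 ?add0r.
Qed.

(** * Perfect matchings as functions *)

(** The perfect matching [M] is the graph of [s], which maps [k] to the partner of
[x'_k]. *)
Definition matched_by (M : {set bip_edge n m}) (s : 'I_n -> 'I_n + 'I_m) : Prop :=
  [/\ injective s, forall k, (s k, k) \in bip_edges Abar Bbar
    & forall l k, ((l, k) \in M) = (l == s k)].

Lemma perfect_matchingP (M : {set bip_edge n m}) :
  perfect_matching Abar Bbar M <-> exists s, matched_by M s.
Proof.
split=> [[[/fintype.subsetP ME Minj] Mcov]|[s [s_inj sE MP]]].
  have /fin_all_exists[s sM] : forall k, exists l, (l, k) \in M.
    by move=> k; have [[l k'] lkM /= <-] := Mcov k; exists l.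
  exists s; split=> [k k' e|k|l k].
  - apply/eqP; apply: contraT => kk'.
    have [|/=] := Minj (s k, k) (s k', k') (sM k) (sM k').
      by rewrite xpair_eqE negb_and kk' orbT.
    by rewrite e eqxx.
  - exact: ME.
  - apply/idP/eqP => [lkM|->//]; apply/eqP; apply: contraT => ls.
    have [|_ /=] := Minj (l, k) (s k, k) lkM (sM k).
      by rewrite xpair_eqE negb_and ls.
    by rewrite eqxx.
have eM e : e \in M -> e.1 = s e.2 by case: e => l k; rewrite MP => /eqP.
split; last by move=> k; exists (s k, k); rewrite // MP.
split; first by apply/fintype.subsetP => -[l k] /eM /= ->.
move=> [l k] [l' k'] /eM /= -> /eM /= ->.
rewrite xpair_eqE (inj_eq s_inj) andbb => kk'; by split.
Qed.

Lemma sum_matched M s (F : bip_edge n m -> R) : matched_by M s ->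
  \sum_(e in M) F e = \sum_k F (s k, k).
Proof.
move=> [_ _ MP]; rewrite (reindex_omap (fun k => (s k, k)) (fun e => Some e.2)).
  by apply: eq_bigl => k; rewrite MP /= !eqxx.
by move=> [l k]; rewrite MP /= => /eqP->.
Qed.

Lemma sum_matched_left M s k : matched_by M s ->
  \sum_r ((inl r, k) \in M)%:R + \sum_j ((inr j, k) \in M)%:R = 1 :> R.
Proof.
move=> [_ _ MP]; transitivity (\sum_l ((l, k) \in M)%:R : R).
  by rewrite big_sumType.
by rewrite (bigD1 (s k)) //= MP eqxx big1 ?addr0 // => l /negPf; rewrite MP => ->.
Qed.

Lemma sum_matched_right M s l : matched_by M s ->
  \sum_k ((l, k) \in M)%:R = [exists k, (l, k) \in M]%:R :> R.
Proof.
move=> [s_inj _ MP]; case: existsP => [[k lk]|nlk].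
  rewrite (bigD1 k) //= lk big1 ?addr0 // => k' k'k.
  by move: lk; rewrite !MP => /eqP->; rewrite (inj_eq s_inj) eq_sym (negPf k'k).
by rewrite big1 // => k _; case: (boolP ((l, k) \in M)) => // lk; case: nlk; exists k.
Qed.

(** * Lower bound on the cost of a feasible flow *)

Lemma conservation (f : edge Abar Bbar -> R) v : feasible_flow f -> v != Vs -> v != Vt ->
  \sum_w arc_flow f v w = \sum_w arc_flow f w v.
Proof. by move=> [_ _ h] vs vt; rewrite -outflowE -inflowE; apply: h. Qed.

Lemma arc_ge0 (f : edge Abar Bbar -> R) v w : feasible_flow f -> 0 <= arc_flow f v w.
Proof.
by case=> f_ge0 _ _; have [vw|vw] := boolP (flow_edge Bbar v w);
  rewrite ?(arcE _ vw) // arc_nonedge.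
Qed.

Lemma arc_le1 (f : edge Abar Bbar -> R) v w : feasible_flow f -> w != Vt -> arc_flow f v w <= 1.
Proof.
case=> _ f_cap _ wt; have [vw|vw] := boolP (flow_edge Bbar v w); last first.
  by rewrite arc_nonedge // ler01.
rewrite (arcE _ vw); apply: le_trans (f_cap _) _; rewrite /capacity /=.
by case: v w wt vw => [||?|?|?|?|?] [||?|?|?|?|?].
Qed.

Lemma arc_x_le1 (f : edge Abar Bbar -> R) r : feasible_flow f -> arc_flow f (Vx r) Vt <= 1.
Proof. by case=> _ f_cap _; rewrite (arcE f (v := Vx r) (w := Vt) isT); apply: f_cap. Qed.

Lemma card_ntl : #|{: ntl Abar}| = num_ntl Abar.
Proof. by rewrite /ntl card_sig. Qed.

(** The SCC's are the images of the [n] vertices under the map sending a vertex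
to its class. *)
Lemma num_ntl_le : (num_ntl Abar <= n)%N.
Proof.
apply: leq_trans (subset_leq_card (_ : ntl_sccs Abar \subset sccs Abar)) _.
  by apply/fintype.subsetP => N; rewrite inE => /andP[].
by rewrite -[X in (_ <= X)%N]card_ord -cardsT leq_imset_card.
Qed.

(** The gaps [1 - f e] on the [q + n] source edges are nonnegative, and their sum
is [q + n] minus the flow value, hence at most 0. *)
Lemma source_saturated (f : edge Abar Bbar -> R) : lp_feasible f ->
  (forall N, arc_flow f Vs (VN N) = 1) /\
  (forall k, arc_flow f Vs (Vx' k) = 1).
Proof.
move=> [ff]; rewrite /flow_value outflowE outflow_s natrD => val_ge.
have gap_N N : true -> 0 <= 1 - arc_flow f Vs (VN N) by rewrite subr_ge0 arc_le1.
have gap_x k : true -> 0 <= 1 - arc_flow f Vs (Vx' k) by rewrite subr_ge0 arc_le1.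
have : \sum_N (1 - arc_flow f Vs (VN N)) + \sum_k (1 - arc_flow f Vs (Vx' k)) <= 0.
  by rewrite !sumrB !sumr_const card_ntl card_ord addrACA -opprD subr_le0.
have sN := sumr_ge0 _ gap_N; have sx := sumr_ge0 _ gap_x.
move=> le0.
have /eqP : \sum_N (1 - arc_flow f Vs (VN N)) +
    \sum_k (1 - arc_flow f Vs (Vx' k)) = 0.
  by apply: le_anti; rewrite le0 addr_ge0.
rewrite paddr_eq0 // => /andP[/eqP N0 /eqP x0].
split=> [N|k]; apply/esym/eqP; rewrite -subr_eq0; apply/eqP.
  exact: (psumr_eq0P gap_N N0).
exact: (psumr_eq0P gap_x x0).
Qed.

(** The flow entering [u'_j] comes from [u_j] and from the SCC's; charging
[pu j] to each of the two separates the matching term from the selection term,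
which are bounded separately. *)
Lemma lp_feasible_cost_ge (pu : 'I_m -> R) (u : ntl Abar -> 'I_m) (w : R)
    (f : edge Abar Bbar -> R) :
  (forall M, perfect_matching Abar Bbar M -> w <= \sum_(e in M) bip_weight pu e) ->
  greedy_selection Bbar pu u -> lp_feasible f ->
  w + \sum_N pu (u N) <= flow_cost pu f.
Proof.
move=> hw hu hf; have [sat_N sat_x] := source_saturated hf.
case: hf => ff _.
have -> : flow_cost pu f = \sum_j pu j * arc_flow f (Vu j) (Vu' j) +
    \sum_N \sum_j pu j * arc_flow f (VN N) (Vu' j).
  rewrite flow_costE exchange_big -big_split; apply: eq_bigr => j _ /=.
  rewrite -mulr_sumr -mulrDr -outflow_u' (conservation ff) // inflow_u'.
  by rewrite addrC.
apply: lerD; last first.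
  apply: ler_sum => N _; have [_ uN_min] := hu N.
  rewrite -[pu _]mulr1 -(sat_N N) -inflow_N -(conservation ff) // outflow_N mulr_sumr.
  apply: ler_sum => j _; have [Nj|Nj] := boolP (flow_edge Bbar (VN N) (Vu' j)).
    by rewrite ler_wpM2r ?uN_min ?arc_ge0.
  by rewrite !arc_nonedge // !mulr0.
pose A k (l : 'I_n + 'I_m) : R :=
  arc_flow f (Vx' k) match l with inl r => Vx r | inr j => Vu j end.
have := @fractional_matching_bound R _ _
  (fun k l => (l, k) \in bip_edges Abar Bbar) (fun k l => bip_weight pu (l, k)) w _ A.
have -> : \sum_k \sum_l bip_weight pu (l, k) * A k l =
    \sum_j pu j * arc_flow f (Vu j) (Vu' j).
  rewrite exchange_big big_sumType /= [X in X + _]big1 ?add0r => [|r _].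
    apply: eq_bigr => j _; rewrite -mulr_sumr -outflow_u (conservation ff) //.
    by rewrite inflow_u.
  by rewrite big1 // => k _; rewrite mul0r.
apply.
- move=> s s_inj sE.
  pose M : {set bip_edge n m} := [set e | e.1 == s e.2].
  have Ms : matched_by M s by split=> // l k; rewrite inE.
  by rewrite -(sum_matched (bip_weight pu) Ms); apply/hw/perfect_matchingP; exists s.
- by move=> k l; apply: arc_ge0.
- by move=> k [r|j]; rewrite inE; apply: contraR => kl; rewrite /A arc_nonedge.
- by move=> k; rewrite big_sumType /= -outflow_x' (conservation ff) // inflow_x'.
- case=> [r|j].
    by rewrite -inflow_x -(conservation ff) // outflow_x arc_x_le1.
  by rewrite -inflow_u -(conservation ff) // outflow_u arc_le1.
Qed.

(** * The constructed flow *)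

Section Constructed.
Variables (pu : 'I_m -> R) (M : {set bip_edge n m}) (s : 'I_n -> 'I_n + 'I_m).
Variable u : ntl Abar -> 'I_m.
Hypothesis Ms : matched_by M s.
Hypothesis uE : forall N, flow_edge Bbar (VN N) (Vu' (u N)).
Let f := constructed_flow R M (selection_set Bbar u).

Lemma selection_val N j (Nj : flow_edge Bbar (VN N) (Vu' j)) :
  (exist (fun e => flow_edge Bbar e.1 e.2) (VN N, Vu' j) Nj
     \in selection_set Bbar u) = (j == u N).
Proof.
rewrite inE /src /tgt /=; apply/existsP/eqP => [[N' /andP[/eqP[<-] /eqP[]]]|->] //.
by exists N; rewrite !eqxx.
Qed.

Lemma selection_pair N j :
  [exists e in selection_set Bbar u, (src e == VN N) && (tgt e == Vu' j)] = (j == u N).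
Proof.
apply/existsP/eqP => [[[e Pe]]|->].
  case/and3P=> eS; rewrite /src /tgt /=; case: e Pe eS => v w /= Pe eS /eqP ? /eqP ?.
  by subst; move: eS; rewrite selection_val => /eqP.
by exists (exist (fun e => flow_edge Bbar e.1 e.2) (VN N, Vu' (u N)) (uE N));
  rewrite selection_val /src /tgt /= !eqxx.
Qed.

Lemma arc_constructed_N N j : arc_flow f (VN N) (Vu' j) = (j == u N)%:R.
Proof.
have [Nj|Nj] := boolP (flow_edge Bbar (VN N) (Vu' j)).
  by rewrite arcE [LHS]/f /constructed_flow /= selection_val.
rewrite arc_nonedge //; case: eqP => // ju; move: Nj; rewrite ju.
by have /= -> := uE N.
Qed.

(** Off the edges of the network both sides vanish, as [M] consists of edges of
the bipartite graph. *)
Lemma arc_constructed_x' k l :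
  arc_flow f (Vx' k) match l with inl r => Vx r | inr j => Vu j end = ((l, k) \in M)%:R.
Proof.
set w := match l with inl _ => _ | _ => _ end.
have [kl|kl] := boolP (flow_edge Bbar (Vx' k) w).
  by rewrite arcE /f /constructed_flow /src /tgt /= {kl}/w; case: l.
rewrite arc_nonedge //; case: Ms => _ sE ->; case: eqP => // ls.
by move: kl (sE k); rewrite -ls inE /w /=; case: l {w ls} => ? /negPf->.
Qed.

Lemma arc_constructed_u' j :
  arc_flow f (Vu' j) Vt = \sum_k ((inr j, k) \in M)%:R + \sum_N (j == u N)%:R.
Proof.
rewrite (arcE f (v := Vu' j) (w := Vt) isT) {1}/f /constructed_flow /=; congr (_ + _).
by apply: eq_bigr => N _; rewrite selection_pair.
Qed.

Lemma constructed_lp_feasible : lp_feasible f.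
Proof.
have fE v w (vw : flow_edge Bbar v w) : arc_flow f v w = f (exist _ (v, w) vw).
  exact: arcE.
have ss : forall v, flow_edge Bbar Vs v -> arc_flow f Vs v = 1 by move=> v sv; rewrite fE.
split; last first.
  rewrite /flow_value outflowE outflow_s.
  under eq_bigr do rewrite ss //. under [X in _ + X]eq_bigr do rewrite ss //.
  by rewrite !sumr_const card_ntl card_ord natrD.
split.
- move=> [[v w] vw]; rewrite /f /constructed_flow /src /tgt /=.
  by case: v w vw => [||N|k|r|j|j] [||N'|k'|r'|j'|j'] //= vw; rewrite ?addr_ge0 ?sumr_ge0.
- move=> [[v w] vw]; rewrite /f /constructed_flow /capacity /src /tgt /=.
  case: v w vw => [||N|k|r|j|j] [||N'|k'|r'|j'|j'] //= vw; rewrite ?lern1 ?leq_b1 //.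
  rewrite (sum_matched_right _ Ms) -natr_sum -natrD ler_nat -add1n leq_add ?leq_b1 //.
  apply: leq_trans num_ntl_le; rewrite -card_ntl -sum1_card leq_sum // => N _.
  exact: leq_b1.
- move=> v vs vt; rewrite outflowE inflowE.
  case: v vs vt => [||N|k|r|j|j] // _ _.
  + rewrite outflow_N inflow_N ss // (bigD1 (u N)) //= arc_constructed_N eqxx.
    by rewrite big1 ?addr0 // => j /negPf ju; rewrite arc_constructed_N ju.
  + rewrite outflow_x' inflow_x' ss // -(sum_matched_left k Ms).
    congr (_ + _); apply: eq_bigr => i _.
      exact: (arc_constructed_x' k (inl i)).
    exact: (arc_constructed_x' k (inr i)).
  + rewrite outflow_x inflow_x (arcE f (v := Vx r) (w := Vt) isT).
    rewrite {1}/f /constructed_flow /=.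
    rewrite -(sum_matched_right _ Ms); apply: eq_bigr => k _.
    by rewrite (arc_constructed_x' k (inl r)).
  + rewrite outflow_u inflow_u (fE (Vu j) (Vu' j) (eqxx j)) {1}/f /constructed_flow /=.
    rewrite -(sum_matched_right _ Ms); apply: eq_bigr => k _.
    by rewrite (arc_constructed_x' k (inr j)).
  + rewrite outflow_u' inflow_u' arc_constructed_u' addrC; congr (_ + _).
      by apply: eq_bigr => N _; rewrite arc_constructed_N.
    rewrite (fE (Vu j) (Vu' j) (eqxx j)) {1}/f /constructed_flow /=.
    by rewrite (sum_matched_right _ Ms).
Qed.

Lemma constructed_cost :
  flow_cost pu f = \sum_(e in M) bip_weight pu e + \sum_N pu (u N).
Proof.
rewrite flow_costE; under eq_bigr do rewrite arc_constructed_u' mulrDr.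
rewrite big_split /=; congr (_ + _).
  have -> : \sum_(e in M) bip_weight pu e =
      \sum_l \sum_k if (l, k) \in M then bip_weight pu (l, k) else 0.
    by rewrite pair_bigA big_mkcond; apply: eq_bigr => -[].
  rewrite big_sumType /= [X in _ = X + _]big1 ?add0r => [|r _].
    apply: eq_bigr => j _; rewrite mulr_sumr; apply: eq_bigr => k _.
    by case: ifP; rewrite ?mulr1 ?mulr0.
  by rewrite big1 // => k _; rewrite if_same.
under eq_bigr do rewrite mulr_sumr; rewrite exchange_big; apply: eq_bigr => N _ /=.
rewrite (bigD1 (u N)) //= eqxx mulr1 big1 ?addr0 // => j /negPf->.
by rewrite mulr0.
Qed.
End Constructed.

End FlowNetwork.

(** * Optimality of the two-stage algorithm *)

Theorem mainTheorem5 (R : realType) (n m : nat)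
    (Abar : 'M[bool]_(n, n)) (Bbar : 'M[bool]_(n, m))
    (pu : 'I_m -> R)
    (hctrl : structurally_controllable R Abar Bbar)
    (hpu : forall j, 0 <= pu j)
    (fA : edge Abar Bbar -> R)
    (hfA : two_stage_output pu fA) :
  (flow_cost pu fA)%:E = lp_optimal_value Abar Bbar pu.
Proof.
case: hfA => M [u [[/perfect_matchingP[s Ms] Mmin] hu ->]].
have uE N : flow_edge Bbar (VN N) (Vu' (u N)) by case: (hu N).
apply: le_anti; apply/andP; split.
  apply: le_ereal_inf_tmp => _ [f hf <-]; rewrite lee_fin (constructed_cost pu M uE).
  exact: lp_feasible_cost_ge.
by apply: ereal_inf_lbound; exists (constructed_flow R M (selection_set Bbar u)) => //;
  apply: constructed_lp_feasible Ms uE.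
Qed.
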